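(* Let the reduced platform profit $\Pi(p,v)$ and its marginal value $M(p,v)$ be as in the context, fix $v\in[0,1]$, and suppose $p\mapsto \Pi(p,v)$ is strictly concave on $[0,1]$. Then the unique profit-maximizing portability level $p^*\in[0,1]$ satisfies: 1. $p^*=0$ if and only if $M(0,v)\le 0$; 2. $p^*\in(0,1)$ if and only if $M(0,v)>0>M(1,v)$, in which case $M(p^*,v)=0$; 3. $p^*=1$ if and only if $M(1,v)\ge 0$. Consequently, a small portability entitlement strictly raises platform profit (that is, there is $\delta>0$ with $\Pi(p,v)>\Pi(0,v)$ for all $p\in(0,\delta)$) if and only if $$N\,\Delta(e(0);0)\,e'(0)>N\,r'(0)\,e(0)+C'(0)+T'(0)+(1-v)H'(0).$$
   Context: $N\ge2$ is an integer, $c>0$. $F,G:[0,\infty)\to\mathbb{R}$ are twice differentiable with $F'>0$, $F''\le0$, $G'>0$, $G''\le0$. $r:[0,1]\to\mathbb{R}$ is twice differentiable with $r'>0$, $r''\le 0$, $r(0)=r_0\ge0$. Developer investment is $e(p)=r(p)/c$, so $e'(p)=r'(p)/c$. The functions $C,T,H:[0,1]\to\mathbb{R}$ (conversion cost, competitive leakage, transfer harm) are continuously differentiable with $C',T',H'\ge 0$ and $H(0)=0$; $k:[0,1]\to\mathbb{R}$ is the verification cost, with $k'>0$, $k''>0$. The reduced platform profit is $$\Pi(p,v)=NF(e(p))+G(Ne(p))-N r(p)e(p)-C(p)-T(p)-H(p)(1-v)-k(v).$$ The investment wedge is $\Delta(e;p)=F'(e)+G'(Ne)-r(p)$, and $$M(p,v)=N\,\Delta(e(p);p)\,e'(p)-N\,r'(p)\,e(p)-C'(p)-T'(p)-(1-v)H'(p),$$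 which is the partial derivative $\Pi_p(p,v)$ (one-sided at $p=0,1$). *)

(* Defs.v *)
From Stdlib Require Import Reals.
Open Scope R_scope.

Definition unit_interval (x : R) : Prop := 0 <= x <= 1.
Definition nonneg_reals (x : R) : Prop := 0 <= x.

(** A function on an interval [D] is a total function of which only the values
    on [D] are used.  [D_in f f' D x] is the limit of the difference quotient
    along points of [D], hence the one-sided derivative at an endpoint of [D];
    [f'] is determined on [D] by [f]. *)
Definition derivative_on (D : R -> Prop) (f f' : R -> R) : Prop :=
  forall x, D x -> D_in f f' D x.

Definition twice_differentiable_on (D : R -> Prop) (f f' f'' : R -> R) : Prop :=
  derivative_on D f f' /\ derivative_on D f' f''.

Definition continuously_differentiable_on (D : R -> Prop) (f f' : R -> R) : Prop :=
  derivative_on D f f' /\ forall x, D x -> continue_in f' D x.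

Definition strictly_concave_on (D : R -> Prop) (f : R -> R) : Prop :=
  forall x y t, D x -> D y -> x <> y -> 0 < t < 1 ->
    t * f x + (1 - t) * f y < f (t * x + (1 - t) * y).

Definition is_maximizer_on (D : R -> Prop) (f : R -> R) (x : R) : Prop :=
  D x /\ forall y, D y -> f y <= f x.

Definition investment (c : R) (r : R -> R) (p : R) : R := r p / c.

Definition investment' (c : R) (r' : R -> R) (p : R) : R := r' p / c.

Definition wedge (N : nat) (F' G' r : R -> R) (e p : R) : R :=
  F' e + G' (INR N * e) - r p.

Definition profit (N : nat) (c : R) (F G r C T H k : R -> R) (p v : R) : R :=
  INR N * F (investment c r p) + G (INR N * investment c r p)
  - INR N * r p * investment c r p
  - C p - T p - H p * (1 - v) - k v.

Definition marginal_profit (N : nat) (c : R) (F' G' r r' C' T' H' : R -> R)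
    (p v : R) : R :=
  INR N * wedge N F' G' r (investment c r p) p * investment' c r' p
  - INR N * r' p * investment c r p
  - C' p - T' p - (1 - v) * H' p.

(* Main.v *)
(** First-order conditions for a concave function.  A differentiable strictly
    concave function on [0,1] lies strictly below each of its tangents, so a
    nonpositive derivative at [0] makes [0] the maximizer and a nonnegative
    derivative at [1] makes [1] the maximizer; conversely the derivative at a
    maximizer is nonpositive in every feasible direction.  The interior case is
    what remains.  That the marginal profit is
    the derivative of the profit is the chain rule, which requires
    [r >= 0] on [0,1] because [F] and [G] are differentiable on [0,oo) only. *)
Require Import Defs.
From Stdlib Require Import Reals Lra.
Open Scope R_scope.

(** * Existence of a maximizer on [0,1] *)

Definition clamp (x : R) : R := Rmax 0 (Rmin 1 x).

Lemma clamp_unit (x : R) : unit_interval (clamp x).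
Proof.
  unfold unit_interval, clamp, Rmax, Rmin.
  repeat destruct Rle_dec; lra.
Qed.

Lemma clamp_id (x : R) : unit_interval x -> clamp x = x.
Proof.
  unfold unit_interval, clamp, Rmax, Rmin.
  repeat destruct Rle_dec; lra.
Qed.

Lemma clamp_contraction (x y : R) : Rabs (clamp y - clamp x) <= Rabs (y - x).
Proof.
  unfold clamp, Rmax, Rmin, Rabs.
  repeat destruct Rle_dec; repeat destruct Rcase_abs; lra.
Qed.

(** [f] is controlled only along [0,1], whereas the extreme value theorem asks for two-sided
    continuity. Composing with the projection onto [0,1] extends [f] to the whole line, and the
    projection being 1-Lipschitz lets the same radius serve. *)
Lemma continuity_clamp (f f' : R -> R) :
  derivative_on unit_interval f f' -> forall x, continuity_pt (fun z => f (clamp z)) x.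
Proof.
  intros Hf x eps Heps.
  destruct (cont_deriv _ _ _ _ (Hf _ (clamp_unit x)) eps Heps) as [d [Hd Hclose]].
  exists d; split; [exact Hd|].
  intros y [_ Hy]; simpl in *; unfold Rdist in *.
  destruct (Req_dec (clamp x) (clamp y)) as [E|E].
  (* The limit given by [cont_deriv] runs over points distinct from [clamp x], so coinciding
     projections are treated apart. *)
  - rewrite E, Rminus_diag, Rabs_R0; exact Heps.
  - apply Hclose; split; [split; [apply clamp_unit|exact E]|].
    eapply Rle_lt_trans; [apply clamp_contraction|exact Hy].
Qed.

Lemma maximizer_exists (f f' : R -> R) :
  derivative_on unit_interval f f' -> exists x, is_maximizer_on unit_interval f x.
Proof.
  intros Hf.
  destruct (continuity_ab_maj (fun z => f (clamp z)) 0 1) as [x [Hmax Hx]];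
    [lra | intros; now apply (continuity_clamp f f') |].
  exists x; split; [exact Hx|].
  intros y Hy; generalize (Hmax y Hy).
  now rewrite !clamp_id.
Qed.

(** * First-order conditions on a convex domain *)

Definition convex_set (D : R -> Prop) : Prop :=
  forall x y t, D x -> D y -> 0 < t < 1 -> D (x + t * (y - x)).

Lemma convex_unit_interval : convex_set unit_interval.
Proof. unfold convex_set, unit_interval; intros; nra. Qed.

Section FirstOrder.

Variables (D : R -> Prop) (f f' : R -> R).
Hypothesis convD : convex_set D.

Lemma directional_expansion (x y eps : R) :
  D_in f f' D x -> D x -> D y -> 0 < eps ->
  exists delta, 0 < delta <= 1 /\ forall t, 0 < t < delta ->
    Rabs (f (x + t * (y - x)) - f x - t * (f' x * (y - x))) < t * eps.
Proof.
  intros Hf Hx Hy Heps.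
  destruct (Req_dec y x) as [->|Hyx].
  { exists 1; split; [lra|]; intros t Ht.
    replace (x + t * (x - x)) with x by ring.
    replace (f x - f x - t * (f' x * (x - x))) with 0 by ring.
    rewrite Rabs_R0; nra. }
  assert (Hh : 0 < Rabs (y - x)) by (apply Rabs_pos_lt; lra).
  destruct (Hf (eps / Rabs (y - x))) as [a [Ha Hlim]].
  { now apply Rdiv_lt_0_compat. }
  simpl in Hlim; unfold Rdist in Hlim.
  (* The point at parameter [t] is at distance [t * Rabs (y - x)] from [x]: the second bound puts it
     within [a], and the bound 1 keeps it on the segment, hence in [D]. *)
  exists (Rmin 1 (a / Rabs (y - x))).
  assert (Hdiv : 0 < a / Rabs (y - x)) by now apply Rdiv_lt_0_compat.
  split; [split; [apply Rmin_glb_lt; lra | apply Rmin_l]|].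
  intros t [Ht0 Ht].
  assert (Ht1 : t < 1) by (eapply Rlt_le_trans; [exact Ht|apply Rmin_l]).
  assert (Hta : t < a / Rabs (y - x)) by (eapply Rlt_le_trans; [exact Ht|apply Rmin_r]).
  assert (Hth : t * (y - x) <> 0) by (apply Rmult_integral_contrapositive; lra).
  set (z := x + t * (y - x)).
  assert (Hzx : z - x = t * (y - x)) by (unfold z; ring).
  assert (Habs : Rabs (z - x) = t * Rabs (y - x))
    by (rewrite Hzx, Rabs_mult, (Rabs_pos_eq t); lra).
  assert (Hq : Rabs ((f z - f x) / (z - x) - f' x) < eps / Rabs (y - x)).
  { apply Hlim; split.
    - split; [apply convD; auto; lra | lra].
    - rewrite Habs; apply (Rmult_lt_compat_r _ _ _ Hh) in Hta.
      unfold Rdiv in Hta; rewrite Rmult_assoc, Rinv_l in Hta; lra. }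
  replace (f z - f x - t * (f' x * (y - x)))
    with ((z - x) * ((f z - f x) / (z - x) - f' x)).
  2: { rewrite Hzx; field; split; [lra|]. intros ->; lra. }
  rewrite Rabs_mult, Habs.
  replace (t * eps) with (t * Rabs (y - x) * (eps / Rabs (y - x))) by (field; lra).
  apply Rmult_lt_compat_l; [nra|exact Hq].
Qed.

(** The tolerance of the expansion is taken to be the slope [f' x * (y - x)] itself, so the error
    cannot cancel the first-order gain. *)
Lemma increasing_direction (x y : R) :
  D_in f f' D x -> D x -> D y -> 0 < f' x * (y - x) ->
  exists delta, 0 < delta <= 1 /\ forall t, 0 < t < delta -> f x < f (x + t * (y - x)).
Proof.
  intros Hf Hx Hy Hpos.
  destruct (directional_expansion x y _ Hf Hx Hy Hpos) as [delta [Hdelta Hexp]].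
  exists delta; split; [exact Hdelta|]; intros t Ht.
  specialize (Hexp t Ht); apply Rabs_def2 in Hexp; lra.
Qed.

Lemma maximizer_derivative (x y : R) :
  D_in f f' D x -> is_maximizer_on D f x -> D y -> f' x * (y - x) <= 0.
Proof.
  intros Hf [Hx Hmax] Hy.
  apply Rnot_lt_le; intros Hpos.
  destruct (increasing_direction x y Hf Hx Hy Hpos) as [delta [Hdelta Hinc]].
  specialize (Hinc (delta / 2)).
  specialize (Hmax (x + delta / 2 * (y - x)) ltac:(apply convD; auto; lra)).
  lra.
Qed.

Hypothesis concf : strictly_concave_on D f.

Lemma strictly_concave_tangent (x y : R) :
  D_in f f' D x -> D x -> D y -> x <> y -> f y < f x + f' x * (y - x).
Proof.
  intros Hf Hx Hy Hxy.
  (* If [f z] exceeded the tangent by a gap, concavity would put [f] more than [t] times that gap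
     above the tangent at parameter [t]. The expansion with the gap as tolerance forbids this for
     small [t]. *)
  assert (Hweak : forall z, D z -> x <> z -> f z <= f x + f' x * (z - x)).
  { intros z Hz Hxz; apply Rnot_lt_le; intros Habove.
    destruct (directional_expansion x z (f z - (f x + f' x * (z - x))) Hf Hx Hz)
      as [delta [Hdelta Hexp]]; [lra|].
    specialize (Hexp (delta / 2) ltac:(lra)).
    generalize (concf z x (delta / 2) Hz Hx ltac:(auto) ltac:(lra)).
    replace (delta / 2 * z + (1 - delta / 2) * x)
      with (x + delta / 2 * (z - x)) by ring.
    apply Rabs_def2 in Hexp; lra. }
  (* Strictness comes from the weak inequality at the midpoint. *)
  generalize (Hweak (x + / 2 * (y - x)) ltac:(apply convD; auto; lra) ltac:(lra))
    (concf y x (/ 2) Hy Hx ltac:(auto) ltac:(lra)).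
  replace (/ 2 * y + (1 - / 2) * x) with (x + / 2 * (y - x)) by lra.
  lra.
Qed.

Lemma strictly_concave_maximizer_unique (x y : R) :
  is_maximizer_on D f x -> is_maximizer_on D f y -> x = y.
Proof.
  intros [Hx Hxmax] [Hy Hymax].
  destruct (Req_dec x y) as [E|E]; [exact E|exfalso].
  generalize (concf y x (/ 2) Hy Hx ltac:(auto) ltac:(lra))
    (Hxmax _ Hy) (Hymax _ Hx)
    (Hxmax (x + / 2 * (y - x)) ltac:(apply convD; auto; lra)).
  replace (/ 2 * y + (1 - / 2) * x) with (x + / 2 * (y - x)) by lra.
  lra.
Qed.

(** The tangent at [x] bounds [f] globally, and no feasible direction climbs along it. *)
Lemma strictly_concave_critical (x : R) :
  D_in f f' D x -> D x -> (forall y, D y -> f' x * (y - x) <= 0) ->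
  is_maximizer_on D f x.
Proof.
  intros Hf Hx Hcrit; split; [exact Hx|]; intros y Hy.
  destruct (Req_dec x y) as [->|Hxy]; [lra|].
  generalize (strictly_concave_tangent x y Hf Hx Hy Hxy) (Hcrit y Hy); lra.
Qed.

End FirstOrder.

(** * Corner and interior cases on [0,1] *)

Lemma unit_interval_maximizer (f f' : R -> R) :
  derivative_on unit_interval f f' -> strictly_concave_on unit_interval f ->
  exists x,
    unique (is_maximizer_on unit_interval f) x /\
    (x = 0 <-> f' 0 <= 0) /\
    ((0 < x < 1 <-> (f' 0 > 0 /\ 0 > f' 1)) /\ (0 < x < 1 -> f' x = 0)) /\
    (x = 1 <-> f' 1 >= 0).
Proof.
  intros Hf Hconc.
  assert (H0 : unit_interval 0) by (unfold unit_interval; lra).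
  assert (H1 : unit_interval 1) by (unfold unit_interval; lra).
  destruct (maximizer_exists f f' Hf) as [x Hmax].
  pose proof (strictly_concave_maximizer_unique _ f convex_unit_interval Hconc) as Huniq.
  assert (Hx : unit_interval x) by apply Hmax.
  pose proof (fun y => maximizer_derivative _ f f' convex_unit_interval x y (Hf x Hx) Hmax)
    as Hfoc.
  pose proof (fun y => strictly_concave_critical _ f f' convex_unit_interval Hconc y) as Hcrit.
  assert (Hzero : x = 0 <-> f' 0 <= 0).
  { split.
    - intros ->; generalize (Hfoc 1 H1); lra.
    - intros Hle; apply Huniq; [exact Hmax|].
      apply Hcrit; auto; unfold unit_interval; intros y Hy; nra. }
  assert (Hone : x = 1 <-> f' 1 >= 0).
  { split.
    - intros ->; generalize (Hfoc 0 H0); lra.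
    - intros Hge; apply Huniq; [exact Hmax|].
      apply Hcrit; auto; unfold unit_interval; intros y Hy; nra. }
  exists x; split; [split; [exact Hmax|]|split; [exact Hzero|split; [split|exact Hone]]].
  - intros y Hy; now apply Huniq.
  (* Being interior means avoiding both corners, so this case follows by negating the two corner
     criteria. *)
  - unfold unit_interval in Hx; split.
    + intros Hin; split; apply Rnot_le_lt; intros Hle.
      * apply Hzero in Hle; lra.
      * apply Rle_ge, Hone in Hle; lra.
    + intros [Hpos Hneg].
      assert (x <> 0) by (intros E; apply Hzero in E; lra).
      assert (x <> 1) by (intros E; apply Hone in E; lra).
      lra.
  (* From an interior point the directions towards 0 and 1 have opposite signs, which forces the
     derivative to vanish. *)
  - intros Hin; generalize (Hfoc 0 H0) (Hfoc 1 H1); nra.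
Qed.

(** A gain at [delta / 2] contradicts the tangent bound at 0 unless the slope there is positive.
    Conversely, moving from 0 towards 1, the parameter of a point is the point itself. *)
Lemma derivative_sign_at_zero (f f' : R -> R) :
  D_in f f' unit_interval 0 -> strictly_concave_on unit_interval f ->
  (exists delta, 0 < delta <= 1 /\ forall p, 0 < p < delta -> f p > f 0) <-> f' 0 > 0.
Proof.
  intros Hf Hconc.
  assert (H0 : unit_interval 0) by (unfold unit_interval; lra).
  assert (H1 : unit_interval 1) by (unfold unit_interval; lra).
  split.
  - intros [delta [Hdelta Hinc]].
    specialize (Hinc (delta / 2) ltac:(lra)).
    assert (Hd : unit_interval (delta / 2)) by (unfold unit_interval; lra).
    generalize (strictly_concave_tangent _ f f' convex_unit_interval Hconc 0 _
      Hf H0 Hd ltac:(lra)).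
    nra.
  - intros Hpos.
    destruct (increasing_direction _ f f' convex_unit_interval 0 1 Hf H0 H1)
      as [delta [Hdelta Hinc]]; [lra|].
    exists delta; split; [exact Hdelta|]; intros p Hp.
    generalize (Hinc p Hp).
    now replace (0 + p * (1 - 0)) with p by ring.
Qed.

(** * Monotonicity, and the derivative of the profit *)

Lemma derivative_pos_ge_zero (f f' : R -> R) :
  derivative_on unit_interval f f' -> (forall x, unit_interval x -> 0 < f' x) ->
  forall x, unit_interval x -> f 0 <= f x.
Proof.
  intros Hf Hpos x Hx.
  assert (Hopp : derivative_on unit_interval (fun z => - f z) (fun z => - f' z))
    by (intros z Hz; apply Dopp, Hf, Hz).
  (* A minimizer [m > 0] would have nonpositive left derivative. *)
  destruct (maximizer_exists _ _ Hopp) as [m Hm].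
  assert (H0 : unit_interval 0) by (unfold unit_interval; lra).
  assert (Hmu : unit_interval m) by apply Hm.
  generalize (maximizer_derivative _ _ _ convex_unit_interval m 0 (Hopp m Hmu) Hm H0)
    (Hpos m Hmu) (proj2 Hm x Hx).
  unfold unit_interval in Hmu; intros Hd Hp Hle; simpl in *.
  assert (E : m = 0) by nra.
  subst m; lra.
Qed.

(** [Dcomp] differentiates along the points of [D] that [f] sends into [E]; the range hypothesis
    makes these all of [D]. *)
Lemma derivative_on_comp (D E : R -> Prop) (f f' g g' : R -> R) :
  (forall x, D x -> E (f x)) ->
  derivative_on D f f' -> derivative_on E g g' ->
  derivative_on D (fun x => g (f x)) (fun x => f' x * g' (f x)).
Proof.
  intros HDE Hf Hg x Hx.
  apply (D_in_imp _ _ (Dgf D E f) D).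
  - intros y Hy; split; auto.
  - apply Dcomp; auto.
Qed.

Lemma profit_derivative
  (N : nat) (c : R) (F F' G G' r r' C C' T T' H H' k : R -> R) (v : R) :
  0 < c ->
  derivative_on nonneg_reals F F' -> derivative_on nonneg_reals G G' ->
  derivative_on unit_interval r r' -> (forall p, unit_interval p -> 0 <= r p) ->
  derivative_on unit_interval C C' -> derivative_on unit_interval T T' ->
  derivative_on unit_interval H H' ->
  derivative_on unit_interval (fun p => profit N c F G r C T H k p v)
    (fun p => marginal_profit N c F' G' r r' C' T' H' p v).
Proof.
  intros hc hF hG hr hrpos hC hT hH.
  assert (he : derivative_on unit_interval
    (fun p => / c * r p) (fun p => / c * r' p)).
  { intros p Hp; apply Dmult_const; auto. }
  assert (hNe : derivative_on unit_interval
    (fun p => INR N * (/ c * r p)) (fun p => INR N * (/ c * r' p))).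
  { intros p Hp; apply (Dmult_const _ (fun q => / c * r q) (fun q => / c * r' q)); auto. }
  assert (hepos : forall p, unit_interval p -> nonneg_reals (/ c * r p)).
  { intros p Hp; apply Rmult_le_pos; [apply Rlt_le, Rinv_0_lt_compat; lra|auto]. }
  assert (hNepos : forall p, unit_interval p -> nonneg_reals (INR N * (/ c * r p))).
  { intros p Hp; apply Rmult_le_pos; [apply pos_INR|now apply hepos]. }
  pose proof (derivative_on_comp _ _ _ _ _ _ hepos he hF) as hFe.
  pose proof (derivative_on_comp _ _ _ _ _ _ hNepos hNe hG) as hGe.
  intros p Hp.
  pose proof (Dmult_const _ _ _ _ (INR N) (hFe p Hp)) as DF.
  pose proof (Dmult _ _ _ _ _ _ (hr p Hp) (he p Hp)) as Dre.
  pose proof (Dmult_const _ _ _ _ (INR N) Dre) as DNre.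
  pose proof (Dmult_const _ _ _ _ (1 - v) (hH p Hp)) as DH.
  pose proof (Dadd _ _ _ _ _ _ DF (hGe p Hp)) as D1.
  pose proof (Dminus _ _ _ _ _ _ D1 DNre) as D2.
  pose proof (Dminus _ _ _ _ _ _ D2 (hC p Hp)) as D3.
  pose proof (Dminus _ _ _ _ _ _ D3 (hT p Hp)) as D4.
  pose proof (Dminus _ _ _ _ _ _ D4 DH) as D5.
  pose proof (Dminus _ _ _ _ _ _ D5 (Dconst unit_interval (k v) p)) as D6.
  cbv beta in D6.
  (* The assembled function and derivative agree with the desired ones only up to ring identities,
     so the limit is opened and the difference quotients are compared. *)
  intros eps Heps; destruct (D6 eps Heps) as [a [Ha Hlim]].
  exists a; split; [exact Ha|]; intros q Hq.
  specialize (Hlim q Hq); simpl in Hlim |- *.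
  unfold profit, marginal_profit, wedge, investment, investment', Rdiv in *.
  (* The arguments of [F], [G] and their derivatives must take the form [r p * / c], since [ring]
     treats these applications as atoms. *)
  rewrite !(Rmult_comm (/ c)) in Hlim.
  match type of Hlim with Rdist ?l ?d < _ =>
    replace (Rdist _ _) with (Rdist l d) by (f_equal; ring)
  end.
  exact Hlim.
Qed.

Theorem proposition2
  (N : nat) (c : R)
  (F F' F'' G G' G'' r r' r'' C C' T T' H H' k k' k'' : R -> R) (v : R)
  (hN : (2 <= N)%nat) (hc : 0 < c)
  (hF : twice_differentiable_on nonneg_reals F F' F'')
  (hF' : forall x, 0 <= x -> 0 < F' x) (hF'' : forall x, 0 <= x -> F'' x <= 0)
  (hG : twice_differentiable_on nonneg_reals G G' G'')
  (hG' : forall x, 0 <= x -> 0 < G' x) (hG'' : forall x, 0 <= x -> G'' x <= 0)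
  (hr : twice_differentiable_on unit_interval r r' r'')
  (hr' : forall p, 0 <= p <= 1 -> 0 < r' p)
  (hr'' : forall p, 0 <= p <= 1 -> r'' p <= 0)
  (hr0 : 0 <= r 0)
  (hC : continuously_differentiable_on unit_interval C C')
  (hC' : forall p, 0 <= p <= 1 -> 0 <= C' p)
  (hT : continuously_differentiable_on unit_interval T T')
  (hT' : forall p, 0 <= p <= 1 -> 0 <= T' p)
  (hH : continuously_differentiable_on unit_interval H H')
  (hH' : forall p, 0 <= p <= 1 -> 0 <= H' p)
  (hH0 : H 0 = 0)
  (hk : twice_differentiable_on unit_interval k k' k'')
  (hk' : forall w, 0 <= w <= 1 -> 0 < k' w)
  (hk'' : forall w, 0 <= w <= 1 -> 0 < k'' w)
  (hv : 0 <= v <= 1) :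
  let Pi := profit N c F G r C T H k in
  let M := marginal_profit N c F' G' r r' C' T' H' in
  let e := investment c r in
  let e' := investment' c r' in
  let Delta := wedge N F' G' r in
  strictly_concave_on unit_interval (fun p => Pi p v) ->
  (exists pstar : R,
     unique (is_maximizer_on unit_interval (fun p => Pi p v)) pstar /\
     (pstar = 0 <-> M 0 v <= 0) /\
     ((0 < pstar < 1 <-> (M 0 v > 0 /\ 0 > M 1 v)) /\
      (0 < pstar < 1 -> M pstar v = 0)) /\
     (pstar = 1 <-> M 1 v >= 0)) /\
  ((exists delta : R, 0 < delta <= 1 /\
      forall p, 0 < p < delta -> Pi p v > Pi 0 v) <->
   INR N * Delta (e 0) 0 * e' 0 >
   INR N * r' 0 * e 0 + C' 0 + T' 0 + (1 - v) * H' 0).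
Proof.
  intros Pi M e e' Delta Hconc.
  assert (hPi : derivative_on unit_interval (fun p => Pi p v) (fun p => M p v)).
  { apply profit_derivative; try apply hF || apply hG || apply hr || apply hC
      || apply hT || apply hH; auto.
    (* [r] increases from [r 0 >= 0], so investment stays in the domain of [F] and [G]. *)
    intros p Hp; apply (Rle_trans _ (r 0)); [exact hr0|].
    apply (derivative_pos_ge_zero r r'); [apply hr|exact hr'|exact Hp]. }
  split; [exact (unit_interval_maximizer _ _ hPi Hconc)|].
  assert (H0 : unit_interval 0) by (unfold unit_interval; lra).
  rewrite (derivative_sign_at_zero _ _ (hPi 0 H0) Hconc).
  (* The stated inequality is [M 0 v > 0] with the cost terms moved to the right. *)
  unfold M, marginal_profit, Delta, e, e'; lra.
Qed.
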